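(* Suppose that $f\in\mathcal P$ and $f(z)=\sum_{n=0}^{\infty}a_nz^n$ with $a_0\in[0,1)$. Let $\Phi_1(r)=\sum_{n=1}^{\infty}\zeta_n(r)$ and $$B_f(\zeta,p,r):=a_0^p\,\zeta_0(r)+\sum_{n=1}^{\infty}|a_n|\zeta_n(r).$$ Then we have the following: (i) If $p\in(0,1]$ and $\{\zeta_n(r)\}_{n=0}^{\infty}\in\mathcal F$ satisfies $$\zeta_0(r)\ge\frac{2}{p}\Phi_1(r)$$ for $r\in[0,R_1]$, where $R_1$ is the minimal positive root of the equation $\zeta_0(r)=\frac{2}{p}\Phi_1(r)$, then the following sharp inequality holds: $$B_f(\zeta,p,r)\le\zeta_0(r)\quad\text{for all } r\le R_1.$$ In the case when $\zeta_0(r)<\frac{2}{p}\Phi_1(r)$ in some interval $(R_1,R_1+\varepsilon)$, the number $R_1$ cannot be improved. (ii) If $p>1$, $p\in\mathbb N$, $\{\zeta_n(r)\}_{n=0}^{\infty}\in\mathcal F$ and $$\zeta_0(r)\ge\frac{2}{1+a_0+\cdots+a_0^{p-1}}\Phi_1(r)$$ for $r\in[0,R_p]$, where $R_p$ is the minimal positive root of the equation $$\zeta_0(r)=\frac{2}{1+a_0+\cdots+a_0^{p-1}}\Phi_1(r),$$ then we have the sharp inequality $$B_f(\zeta,p,r)\le\zeta_0(r)\quad\text{for all } r\le R_p.$$ In particular, when $p=2$, $B_f(\zeta,2,r)\le\zeta_0(r)$ for all $r\le R_2$, where $R_2$ is the root of $\zeta_0(r)=\frac{2}{1+a_0}\P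hi_1(r)$.
   Context: $\mathbb D=\{z\in\mathbb C:|z|<1\}$. $\mathcal P$ is the class of analytic functions $f$ on $\mathbb D$ with $\operatorname{Re} f(z)<1$ for all $z\in\mathbb D$. $\mathcal F$ is the set of all sequences $\zeta=\{\zeta_n(r)\}_{n=0}^\infty$ of nonnegative continuous functions on $[0,1)$ such that $\sum_{n=0}^\infty\zeta_n(r)$ converges locally uniformly with respect to $r\in[0,1)$. *)

(* Defs.v *)
(* Stdlib reals with Coquelicot. *)
From Stdlib Require Import Reals.
From Coquelicot Require Import Coquelicot.

Open Scope R_scope.

(* Functions on the disk are total functions [C -> C] of which only the values
   on the disk matter; [ex_derive] is over [C_AbsRing], i.e. complex
   differentiability, so the first conjunct says that [f] is holomorphic. *)
Definition class_P (f : C -> C) : Prop :=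
  (forall z : C, Cmod z < 1 -> ex_derive f z) /\
  (forall z : C, Cmod z < 1 -> Re (f z) < 1).

Definition power_series_on_disk (f : C -> C) (a : nat -> C) : Prop :=
  forall z : C, Cmod z < 1 -> is_pseries a z (f z).

(* Only the restriction of each [zeta n] to [0,1) matters; neighbourhoods,
   hence continuity at 0, are relative to [0,1). *)
Definition class_F (zeta : nat -> R -> R) : Prop :=
  (forall n r, 0 <= r < 1 -> 0 <= zeta n r) /\
  (forall n, continuous_on (fun r => 0 <= r < 1) (zeta n)) /\
  (forall r, 0 <= r < 1 -> exists delta : posreal,
     CVU_dom (fun N s => sum_n (fun n => zeta n s) N)
             (fun s => 0 <= s < 1 /\ Rabs (s - r) < delta)).

(* Stdlib's [Rpower 0 y] is 1; here [rpow 0 y = 0], the usual value of 0^y for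
   y > 0, the only exponents used. *)
Definition rpow (x y : R) : R := if Req_EM_T x 0 then 0 else Rpower x y.

Definition Phi1 (zeta : nat -> R -> R) (r : R) : R :=
  Series (fun n => zeta (S n) r).

Definition B_tail (a : nat -> C) (zeta : nat -> R -> R) (r : R) (n : nat) : R :=
  Cmod (a (S n)) * zeta (S n) r.

(* [B_f(zeta,p,r)], as a function of the Taylor coefficients [a] of [f]; [a 0]
   is real wherever this is used.  [Series] is total, so [B_le_zeta0] also
   asserts that the series converges. *)
Definition B (a : nat -> C) (zeta : nat -> R -> R) (p r : R) : R :=
  rpow (Re (a O)) p * zeta O r + Series (B_tail a zeta r).

Definition B_le_zeta0 (a : nat -> C) (zeta : nat -> R -> R) (p r : R) : Prop :=
  ex_series (B_tail a zeta r) /\ B a zeta p r <= zeta O r.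

Definition admissible (f : C -> C) (a : nat -> C) : Prop :=
  class_P f /\ power_series_on_disk f a /\
  exists a0 : R, a O = RtoC a0 /\ 0 <= a0 < 1.

(* The functions involved live on [0,1), so roots are sought there. *)
Definition is_min_pos_root (g h : R -> R) (rho : R) : Prop :=
  0 < rho < 1 /\ g rho = h rho /\ (forall r, 0 < r < rho -> g r <> h r).

(* Main.v *)
Require Import Defs.
From Stdlib Require Import Reals Lra Lia.
From Coquelicot Require Import Coquelicot.

(** If Re f < 1 then |a_n| <= 2 (1 - Re a_0) for n >= 1: on |z| = r the function
    1 - Re f is positive, and its average against the nonnegative weight
    1 + cos (arg a_n + n t) is 1 - Re a_0 - |a_n| r^n / 2.  To stay with finite
    sums, the average is taken over roots of unity, after truncating the series,
    where it is exact for trigonometric polynomials of low degree.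
    Hence B_f <= a_0^p zeta_0 + 2 (1 - a_0) Phi_1, and it remains to compare
    1 - a_0^p with p (1 - a_0), resp. with (1 + ... + a_0^(p-1)) (1 - a_0).
    Equality in the bound on B_f holds for
    f(z) = a_0 - 2 (1 - a_0) z / (1 - z); letting a_0 tend to 1 gives sharpness
    in (i), since (1 - x^p) / (1 - x) tends to p. *)

Open Scope R_scope.

(** * Trigonometric sums over roots of unity *)

(** Telescoping: [2 * sin (theta / 2) * cos x] is the difference of the sines at [x + theta / 2] and
    [x - theta / 2]. *)
Lemma sum_cos_arith (phi theta : R) (N : nat) :
  2 * sin (theta / 2) * sum_n (fun k => cos (phi + INR k * theta)) N =
  sin (phi + INR (S N) * theta - theta / 2) - sin (phi - theta / 2).
Proof.
  assert (Hstep : forall x, 2 * sin (theta / 2) * cos x =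
            sin (x + theta / 2) - sin (x - theta / 2)).
  { intros x. rewrite sin_plus, sin_minus. ring. }
  induction N as [|N IH].
  - rewrite sum_O, Hstep. f_equal; f_equal; simpl; field.
  - rewrite sum_Sn. unfold plus; simpl plus. rewrite Rmult_plus_distr_l, IH, Hstep.
    rewrite (S_INR (S N)).
    replace (phi + (INR (S N) + 1) * theta - theta / 2)
      with (phi + INR (S N) * theta + theta / 2) by field.
    lra.
Qed.

(** With [theta] equal to 2 pi j / (N+1), the two end terms of the telescoped sum differ by j full
    turns and cancel. The factor [sin (theta / 2)] can be divided out because pi |j| / (N+1) lies
    strictly between 0 and pi; negative j reduces to positive j by oddness of the sine. *)
Lemma sum_cos_roots_of_unity (phi : R) (j : Z) (N : nat) :
  (0 < Z.abs j < Z.of_nat (S N))%Z ->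
  sum_n (fun k => cos (phi + IZR j * (INR k * (2 * PI / INR (S N))))) N = 0.
Proof.
  intros Hj.
  set (theta := IZR j * (2 * PI / INR (S N))).
  assert (HK : 0 < INR (S N)) by (apply lt_0_INR; lia).
  rewrite (sum_n_ext _ (fun k => cos (phi + INR k * theta)))
    by (intros k; unfold theta; f_equal; ring).
  assert (Hs : sin (theta / 2) <> 0).
  { assert (Hgen : forall i : Z, (0 < i < Z.of_nat (S N))%Z ->
               0 < sin (IZR i * (2 * PI / INR (S N)) / 2)).
    { intros i [Hi1 Hi2]. apply IZR_lt in Hi1, Hi2. rewrite <- INR_IZR_INZ in Hi2.
      replace (IZR i * (2 * PI / INR (S N)) / 2) with (IZR i / INR (S N) * PI)
        by (field; lra).
      assert (0 < IZR i / INR (S N) < 1).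
      { split; [apply Rdiv_lt_0_compat; lra|].
        apply Rmult_lt_reg_r with (INR (S N)); [lra|]. field_simplify; lra. }
      pose proof PI_RGT_0. apply sin_gt_0; nra. }
    unfold theta. destruct (Z.lt_ge_cases 0 j).
    - specialize (Hgen j). apply Rgt_not_eq, Hgen. lia.
    - specialize (Hgen (- j)%Z ltac:(lia)). rewrite opp_IZR in Hgen.
      replace (- IZR j * (2 * PI / INR (S N)) / 2)
        with (- (IZR j * (2 * PI / INR (S N)) / 2)) in Hgen by (field; lra).
      rewrite sin_neg in Hgen. lra. }
  pose proof (sum_cos_arith phi theta N) as H.
  replace (phi + INR (S N) * theta - theta / 2)
    with (phi - theta / 2 + 2 * IZR j * PI) in H
    by (unfold theta; field; lra).
  assert (Hper : forall x, sin (x + 2 * IZR j * PI) = sin x).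
  { intros x. rewrite sin_plus.
    replace (2 * IZR j * PI) with (2 * (IZR j * PI)) by ring.
    rewrite sin_2a, cos_2a_sin.
    rewrite (sin_eq_0_1 (IZR j * PI)) by (exists j; reflexivity). ring. }
  rewrite Hper in H.
  apply Rmult_eq_reg_l with (2 * sin (theta / 2)); lra.
Qed.

(** The product formula for cosines leaves the frequencies m, m + n and m - n. Since m + n <= N,
    none of them is a nonzero multiple of N + 1, so only a frequency equal to 0 contributes: m
    itself, or m - n. *)
Lemma trig_moment (phi psi : R) (m n N : nat) :
  (0 < n)%nat -> (m + n <= N)%nat ->
  sum_n (fun k => cos (phi + INR m * (INR k * (2 * PI / INR (S N)))) *
                  (1 + cos (psi + INR n * (INR k * (2 * PI / INR (S N)))))) N =
  INR (S N) * ((if Nat.eqb m 0 then cos phi else 0) +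
               (if Nat.eqb m n then cos (phi - psi) / 2 else 0)).
Proof.
  intros Hn HmN.
  set (t := fun k => INR k * (2 * PI / INR (S N))).
  rewrite (sum_n_ext _ (fun k => plus
      (cos (phi + IZR (Z.of_nat m) * t k))
      (plus (mult (K := R_Ring) (/ 2) (cos (phi + psi + IZR (Z.of_nat m + Z.of_nat n) * t k)))
            (mult (K := R_Ring) (/ 2) (cos (phi - psi + IZR (Z.of_nat m - Z.of_nat n) * t k)))))).
  2:{ intros k. unfold plus, mult; cbn -[INR IZR]. fold (t k).
      rewrite plus_IZR, minus_IZR, <- !INR_IZR_INZ.
      replace (phi + psi + (INR m + INR n) * t k)
        with ((phi + INR m * t k) + (psi + INR n * t k)) by ring.
      replace (phi - psi + (INR m - INR n) * t k)
        with ((phi + INR m * t k) - (psi + INR n * t k)) by ring.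
      rewrite (cos_plus (phi + _)), (cos_minus (phi + _)). field. }
  rewrite !sum_n_plus, !(sum_n_mult_l (K := R_Ring)).
  assert (Hzero : forall x, sum_n (fun k => cos (x + IZR 0 * t k)) N = INR (S N) * cos x).
  { intros x. rewrite (sum_n_ext _ (fun _ => cos x)) by (intros; f_equal; ring).
    apply sum_n_const. }
  assert (Hroots : forall x j, (0 < Z.abs j < Z.of_nat (S N))%Z ->
            sum_n (fun k => cos (x + IZR j * t k)) N = 0)
    by (intros x j; apply sum_cos_roots_of_unity).
  rewrite (Hroots (phi + psi)) by lia.
  unfold plus, mult; cbn -[INR IZR sum_n Nat.eqb].
  match goal with |- @eq _ ?l ?r => change (@eq R l r) end.
  destruct (Nat.eqb_spec m 0) as [Hm0|Hm0]; destruct (Nat.eqb_spec m n) as [He|Hne];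
    try lia.
  - subst m. rewrite Hzero.
    rewrite (Hroots (phi - psi)) by lia. ring.
  - subst m. rewrite Z.sub_diag, Hzero, Hroots by lia. field.
  - rewrite !Hroots by lia. ring.
Qed.

(** * Coefficient bound for trigonometric series *)

(** The point is uniformity: [N0] depends on the majorant [b] only, so one truncation serves a
    trigonometric series at all angles. *)
Lemma series_remainder_small (b : nat -> R) (eps : R) :
  (forall m, 0 <= b m) -> ex_series b -> 0 < eps ->
  exists N0, forall N x, (N0 <= N)%nat -> (forall m, Rabs (x m) <= b m) ->
    Rabs (Series x - sum_n x N) <= eps.
Proof.
  intros Hb Hex Heps.
  pose proof (Series_correct b Hex) as Hlim.
  assert (Hl : is_lim_seq (sum_n b) (Series b)) by exact Hlim.
  apply is_lim_seq_spec in Hl. destruct (Hl (mkposreal eps Heps)) as [N0 HN0].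
  exists N0. intros N x HN Hx.
  assert (Hexx : ex_series (fun m => Rabs (x m))).
  { apply (ex_series_le (V := R_CompleteNormedModule) _ b); [|exact Hex].
    intros m. unfold norm; simpl. unfold abs; simpl. rewrite Rabs_Rabsolu. apply Hx. }
  assert (Hsplit : forall y : nat -> R, ex_series y ->
    Series y - sum_n y N = Series (fun k => y (S N + k)%nat)).
  { intros y Hy. rewrite (Series_incr_n y (S N)) by (lia || exact Hy).
    rewrite sum_n_Reals. simpl Init.Nat.pred. ring. }
  rewrite (Hsplit x) by (apply ex_series_Rabs, Hexx).
  apply Rle_trans with (Series (fun k => Rabs (x (S N + k)%nat))).
  { apply Series_Rabs. apply (ex_series_incr_n (fun m => Rabs (x m)) (S N)), Hexx. }
  apply Rle_trans with (Series (fun k => b (S N + k)%nat)).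
  { apply Series_le; [|apply (ex_series_incr_n b (S N)), Hex].
    intros k. split; [apply Rabs_pos | apply Hx]. }
  rewrite <- (Hsplit b Hex). specialize (HN0 N HN). simpl in HN0.
  apply Rabs_def2 in HN0. lra.
Qed.

Lemma sum_n_two_terms (u v : R) (n N : nat) :
  (0 < n <= N)%nat ->
  sum_n (fun m => (if Nat.eqb m 0 then u else 0) + (if Nat.eqb m n then v else 0)) N
  = u + v.
Proof.
  intros [Hn HnN].
  assert (Hall : forall M, sum_n (fun m =>
      (if Nat.eqb m 0 then u else 0) + (if Nat.eqb m n then v else 0)) M
      = u + if Nat.leb n M then v else 0).
  { induction M as [|M IH].
    - rewrite sum_O. destruct n; [lia|]. reflexivity.
    - rewrite sum_Sn, IH. unfold plus; cbn -[Nat.eqb Nat.leb].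
      match goal with |- @eq _ ?l ?r => change (@eq R l r) end.
      destruct (Nat.eqb_spec (S M) 0); [lia|].
      destruct (Nat.leb_spec n M); destruct (Nat.leb_spec n (S M));
        destruct (Nat.eqb_spec (S M) n); try lia; ring. }
  rewrite Hall. destruct (Nat.leb_spec n N); [reflexivity|lia].
Qed.

Lemma trig_series_coeff_bound (b phi : nat -> R) (A : R) (n : nat) :
  (forall m, 0 <= b m) -> ex_series b ->
  (forall t, Series (fun m => b m * cos (phi m + INR m * t)) <= A) ->
  (0 < n)%nat -> b n <= 2 * (A - b O * cos (phi O)).
Proof.
  intros Hb Hex HA Hn. apply le_epsilon. intros e He.
  destruct (series_remainder_small b (e / 2) Hb Hex ltac:(lra)) as [N0 HN0].
  (* [N] is at least [n], so the truncation keeps the n-th term; [L] is large enough for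
     [trig_moment] at every frequency m <= [N]. *)
  set (N := (N0 + n)%nat). set (L := (N + n)%nat).
  set (t := fun k => INR k * (2 * PI / INR (S L))).
  set (P := fun s => sum_n (fun m => b m * cos (phi m + INR m * s)) N : R).
  (* [ker] is nonnegative with mean 1 over the points [t k]. *)
  set (ker := fun k => 1 + cos (phi n + INR n * t k)).
  assert (HK : 0 < INR (S L)) by (apply lt_0_INR; lia).
  assert (HP : forall s, P s <= A + e / 2).
  { intros s. specialize (HN0 N (fun m => b m * cos (phi m + INR m * s)) ltac:(lia)).
    assert (Hdom : forall m, Rabs (b m * cos (phi m + INR m * s)) <= b m).
    { intros m. rewrite Rabs_mult, (Rabs_right (b m)) by (apply Rle_ge, Hb).
      rewrite <- (Rmult_1_r (b m)) at 2. apply Rmult_le_compat_l; [apply Hb|].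
      apply Rabs_le, COS_bound. }
    specialize (HN0 Hdom). apply Rabs_le_between in HN0. specialize (HA s).
    unfold P. lra. }
  assert (Hle : sum_n (fun k => P (t k) * ker k) L
                <= sum_n (fun k => (A + e / 2) * ker k) L).
  { rewrite !sum_n_Reals. apply sum_Rle. intros k _.
    apply Rmult_le_compat_r; [|apply HP].
    unfold ker. pose proof (COS_bound (phi n + INR n * t k)). lra. }
  assert (Hmom0 : sum_n ker L = INR (S L)).
  { pose proof (trig_moment 0 (phi n) 0 n L Hn ltac:(lia)) as H. simpl Nat.eqb in H.
    destruct n as [|n']; [lia|]. simpl Nat.eqb in H. cbv iota in H.
    rewrite cos_0 in H. replace (INR (S L) * (1 + 0)) with (INR (S L)) in H by ring.
    rewrite <- H. apply sum_n_ext. intros k. unfold ker, t.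
    replace (0 + INR 0 * (INR k * (2 * PI / INR (S L)))) with 0 by (simpl; ring).
    rewrite cos_0. symmetry. apply Rmult_1_l. }
  assert (HmomP : sum_n (fun k => P (t k) * ker k) L
                  = INR (S L) * (b O * cos (phi O) + b n / 2)).
  { rewrite (sum_n_ext _ (fun k => sum_n (fun m =>
       b m * (cos (phi m + INR m * t k) * ker k)) N)).
    2:{ intros k. unfold P.
        rewrite <- (sum_n_mult_r (K := R_Ring) (ker k)). apply sum_n_ext.
        intros m. unfold mult; simpl. ring. }
    rewrite sum_n_switch.
    rewrite <- (sum_n_two_terms (b O * cos (phi O)) (b n / 2) n N) by lia.
    rewrite <- (sum_n_mult_l (K := R_Ring) (INR (S L))).
    apply sum_n_ext_loc. intros m Hm.
    rewrite (sum_n_mult_l (K := R_Ring) (b m)).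
    unfold ker, t. rewrite trig_moment by lia.
    unfold mult; cbn -[INR Nat.eqb].
    match goal with |- @eq _ ?l ?r => change (@eq R l r) end.
    destruct (Nat.eqb_spec m 0); destruct (Nat.eqb_spec m n); subst; try lia; try ring.
    rewrite Rminus_diag, cos_0. field. }
  assert (HmomA : sum_n (fun k => (A + e / 2) * ker k) L = (A + e / 2) * INR (S L)).
  { rewrite <- Hmom0. exact (sum_n_mult_l (K := R_Ring) (A + e / 2) ker L). }
  (* After division by the number of points: b_0 cos phi_0 + b_n / 2 <= A + e / 2. *)
  rewrite HmomP, HmomA, (Rmult_comm (A + e / 2)) in Hle.
  apply Rmult_le_reg_l in Hle; lra.
Qed.

(** * Polar form, and the coefficient bound for the class P *)

(** An argument of [c]: [acos] covers the closed upper half-plane, and the lower one is reached by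
    reflection. The value at 0 is harmless, since the cosine and sine of [Carg c] always come
    multiplied by [Cmod c]. *)
Definition Carg (c : C) : R :=
  if Rle_dec 0 (Im c) then acos (Re c / Cmod c) else - acos (Re c / Cmod c).

Lemma Carg_polar (c : C) :
  Cmod c * cos (Carg c) = Re c /\ Cmod c * sin (Carg c) = Im c.
Proof.
  pose proof (Cmod_ge_0 c) as Hm. pose proof (Cmod2_alt c) as H2.
  destruct Hm as [Hm|Hm].
  - assert (Hx : -1 <= Re c / Cmod c <= 1).
    { apply Rabs_le_between. unfold Rdiv.
      rewrite Rabs_mult, Rabs_inv, (Rabs_right (Cmod c)) by lra.
      apply Rle_div_l; [lra|]. pose proof (re_le_Cmod c). lra. }
    assert (Hs : Cmod c * sin (acos (Re c / Cmod c)) = Rabs (Im c)).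
    { rewrite sin_acos by exact Hx. rewrite <- (sqrt_Rsqr (Cmod c)) at 1 by lra.
      rewrite <- sqrt_mult_alt by apply Rle_0_sqr. rewrite <- sqrt_Rsqr_abs.
      f_equal. unfold Rsqr. field_simplify; lra. }
    unfold Carg. destruct (Rle_dec 0 (Im c)) as [Hi|Hi].
    + rewrite cos_acos, Hs, Rabs_right by lra. split; [field; lra|reflexivity].
    + rewrite cos_neg, sin_neg, cos_acos by lra. rewrite Rabs_left in Hs by lra.
      split; [field|]; lra.
  - rewrite <- Hm in *. split; nra.
Qed.

Lemma Cpow_polar (r t : R) (m : nat) :
  (((r * cos t)%R, (r * sin t)%R) ^ m)%C = (r ^ m * cos (INR m * t), r ^ m * sin (INR m * t)).
Proof.
  induction m as [|m IH].
  - simpl. rewrite Rmult_0_l, cos_0, sin_0. unfold RtoC. f_equal; ring.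
  - rewrite Cpow_S, IH, S_INR, Rmult_plus_distr_r, Rmult_1_l, cos_plus, sin_plus.
    unfold Cmult. simpl. f_equal; ring.
Qed.

(** Brings the real part of a power series on the circle of radius r into the form required by
    [trig_series_coeff_bound]. *)
Lemma Re_polar_term (c : C) (r t : R) (m : nat) :
  Re ((((r * cos t)%R, (r * sin t)%R) ^ m) * c)%C
  = Cmod c * r ^ m * cos (Carg c + INR m * t).
Proof.
  destruct (Carg_polar c) as [Hre Him].
  rewrite Cpow_polar, re_mult, <- Hre, <- Him, cos_plus. simpl. ring.
Qed.

Lemma is_series_Re (u : nat -> C) (l : C) :
  is_series (V := C_NormedModule) u l -> is_series (fun n => Re (u n)) (Re l).
Proof.
  intros H. apply filterlim_locally. intros eps.
  assert (Hs : forall n, sum_n (fun k => Re (u k)) n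
                         = Re (sum_n (G := C_NormedModule) u n)).
  { induction n as [|n IH]; [rewrite !sum_O; reflexivity|].
    rewrite !sum_Sn, IH. reflexivity. }
  destruct (proj1 (filterlim_locally _ _) H eps) as [N HN].
  exists N. intros n Hn. rewrite Hs. exact (proj1 (HN n Hn)).
Qed.

Lemma series_terms_bounded (u : nat -> C) (l : C) :
  is_series (V := C_NormedModule) u l ->
  exists (N : nat) (M : R), forall n, (N <= n)%nat -> Cmod (u n) <= M.
Proof.
  intros H.
  destruct (proj1 (filterlim_locally _ _) H (mkposreal 1 Rlt_0_1)) as [N HN].
  (* A term is the difference of two consecutive partial sums. Unit balls in [C] are squares, so
     each of these sums is within [sqrt 2] of the limit in modulus. *)
  exists (S N), (2 * sqrt 2). intros [|n] Hn; [lia|].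
  pose proof (C_NormedModule_mixin_compat2 _ _ _ (HN n ltac:(lia))) as H1.
  pose proof (C_NormedModule_mixin_compat2 _ _ _ (HN (S n) ltac:(lia))) as H2.
  rewrite sum_Sn in H2. set (s := sum_n (G := C_NormedModule) u n) in *. clearbody s.
  change (Cmod ((s : C) - l) < sqrt 2 * 1) in H1.
  change (Cmod (((s : C) + u (S n)) - l) < sqrt 2 * 1) in H2.
  pose proof (Cmod_triangle (s + u (S n) - l) (- (s - l))) as Ht.
  rewrite Cmod_opp in Ht.
  replace (s + u (S n) - l + - (s - l))%C with (u (S n)) in Ht by ring. lra.
Qed.

(** Convergence at an intermediate radius [rho] bounds the terms |a_m| rho^m eventually, and the
    series at r is then dominated by a geometric one of ratio r / rho. *)
Lemma power_series_abs_conv (f : C -> C) (a : nat -> C) (r : R) :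
  power_series_on_disk f a -> 0 <= r < 1 ->
  ex_series (fun m => Cmod (a m) * r ^ m).
Proof.
  intros Hf Hr. set (rho := (1 + r) / 2).
  assert (Hrho : 0 < rho < 1) by (unfold rho; lra).
  assert (Hz : Cmod (RtoC rho) < 1) by (rewrite Cmod_R, Rabs_right; lra).
  destruct (series_terms_bounded _ _ (Hf _ Hz)) as (N & M & HN).
  apply (ex_series_incr_n _ N).
  apply (ex_series_le (V := R_CompleteNormedModule) _
           (fun k => M * (r / rho) ^ N * (r / rho) ^ k)).
  2:{ apply (ex_series_scal (K := R_AbsRing) (V := R_NormedModule) (M * (r / rho) ^ N)), ex_series_geom.
      rewrite Rabs_right.
      - apply Rlt_div_l; unfold rho in *; lra.
      - apply Rle_ge, Rdiv_le_0_compat; lra. }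
  intros k.
  specialize (HN (N + k)%nat ltac:(lia)).
  change (Cmod (RtoC rho ^ (N + k) * a (N + k)%nat) <= M) in HN.
  rewrite Cmod_mult, Cmod_pow, Cmod_R, Rabs_right in HN by lra.
  change (Rabs (Cmod (a (N + k)%nat) * r ^ (N + k)) <= M * (r / rho) ^ N * (r / rho) ^ k).
  rewrite Rabs_right.
  2:{ apply Rle_ge, Rmult_le_pos; [apply Cmod_ge_0|apply pow_le; lra]. }
  rewrite Rmult_assoc, <- pow_add.
  replace (r ^ (N + k)) with (rho ^ (N + k) * (r / rho) ^ (N + k)).
  2:{ rewrite <- Rpow_mult_distr. f_equal. field. lra. }
  assert (H : 0 <= (r / rho) ^ (N + k)) by (apply pow_le, Rdiv_le_0_compat; lra).
  rewrite <- Rmult_assoc. apply Rmult_le_compat_r; lra.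
Qed.

(** Bernoulli's inequality, which makes the passage r -> 1 in |a_n| r^n quantitative. *)
Lemma one_minus_pow_le (r : R) (n : nat) : 0 <= r <= 1 -> 1 - INR n * (1 - r) <= r ^ n.
Proof.
  intros Hr. induction n as [|n IH]; [simpl; lra|].
  rewrite S_INR. simpl pow. pose proof (pos_INR n).
  apply (Rmult_le_compat_l r) in IH; [|lra].
  assert (0 <= INR n * (1 - r) ^ 2) by (apply Rmult_le_pos; [lra|apply pow2_ge_0]).
  nra.
Qed.

Lemma class_P_coeff_bound (f : C -> C) (a : nat -> C) (n : nat) :
  class_P f -> power_series_on_disk f a -> (0 < n)%nat ->
  Cmod (a n) <= 2 * (1 - Re (a O)).
Proof.
  intros [_ HP] Hf Hn.
  assert (Hr : forall r, 0 <= r < 1 -> Cmod (a n) * r ^ n <= 2 * (1 - Re (a O))).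
  { intros r Hr. destruct (Carg_polar (a O)) as [H0 _].
    replace (Re (a O)) with (Cmod (a O) * r ^ 0 * cos (Carg (a O)))
      by (simpl; rewrite Rmult_1_r; exact H0).
    apply (trig_series_coeff_bound (fun m => Cmod (a m) * r ^ m) (fun m => Carg (a m)) 1);
      [| |intros t|exact Hn].
    - intros m. apply Rmult_le_pos; [apply Cmod_ge_0|apply pow_le; lra].
    - exact (power_series_abs_conv f a r Hf Hr).
    - set (z := (r * cos t, r * sin t) : C).
      assert (Hz : Cmod z < 1).
      { pose proof (Cmod2_alt z) as H. unfold z at 2 3 in H. simpl Re in H; simpl Im in H.
        pose proof (sin2_cos2 t) as Hsc. unfold Rsqr in Hsc.
        pose proof (Cmod_ge_0 z). nra. }
      rewrite (is_series_unique _ (Re (f z))); [left; apply HP, Hz|].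
      eapply is_series_ext; [|exact (is_series_Re _ _ (Hf z Hz))].
      intros m. exact (Re_polar_term (a m) r t m). }
  apply le_epsilon. intros e He.
  pose proof (Cmod_ge_0 (a n)) as Hc. pose proof (pos_INR n) as HnR.
  set (K := Cmod (a n) * INR n).
  assert (HK : 0 <= K) by (unfold K; nra).
  (* Chosen so that 0 < d < 1 and K d <= e; the radius used is 1 - d. *)
  set (d := e / (K + 1 + e)).
  assert (Hd : d * (K + 1 + e) = e) by (unfold d; field; lra).
  assert (Hd01 : 0 < d < 1).
  { split; [apply Rdiv_lt_0_compat; lra|]. unfold d. apply Rlt_div_l; lra. }
  specialize (Hr (1 - d) ltac:(lra)).
  pose proof (one_minus_pow_le (1 - d) n ltac:(lra)) as Hp.
  apply (Rmult_le_compat_l _ _ _ Hc) in Hp.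
  replace (Cmod (a n) * (1 - INR n * (1 - (1 - d)))) with (Cmod (a n) - K * d) in Hp
    by (unfold K; ring).
  nra.
Qed.

(** * The extremal function *)

Lemma one_minus_neq_0 (z : C) : Cmod z < 1 -> (1 - z)%C <> 0.
Proof.
  intros Hz H. assert (z = 1%C) as -> by (rewrite <- (Cplus_0_r z), <- H; ring).
  rewrite Cmod_1 in Hz. lra.
Qed.

(** The error of the linear approximation with slope 1 / (1-z)^2 is exactly (y-z)^2 / ((1-y)
    (1-z)^2). *)
Lemma inv_one_minus_ex_derive (z : C) :
  Cmod z < 1 -> ex_derive (fun w : C => (/ (1 - w))%C : C_NormedModule) z.
Proof.
  intros Hz. set (d := (1 - z)%C).
  assert (Hd : d <> 0) by apply one_minus_neq_0, Hz.
  pose proof (proj1 (Cmod_gt_0 d) Hd) as Hm.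
  exists (/ (d * d))%C. split; [apply is_linear_scal_l|].
  intros x Hx. apply (is_filter_lim_locally_unique (K := C_AbsRing) (V := AbsRing_NormedModule C_AbsRing)) in Hx. subst x.
  intros eps. pose proof (cond_pos eps) as He.
  set (m := Cmod d) in *.
  (* The first radius keeps |1 - y| >= m / 2; the second then gives |y - z| <= eps |1 - y| m^2. *)
  assert (Hdel : 0 < Rmin (m / 2) (eps * m ^ 3 / 2)).
  { apply Rmin_glb_lt; [lra|]. apply Rdiv_lt_0_compat; [|lra].
    apply Rmult_lt_0_compat; [lra|]. apply pow_lt, Hm. }
  exists (mkposreal _ Hdel). intros y Hy.
  change (Cmod (y - z) < Rmin (m / 2) (eps * m ^ 3 / 2)) in Hy.
  assert (Hy1 := Rlt_le_trans _ _ _ Hy (Rmin_l _ _)).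
  assert (Hy2 := Rlt_le_trans _ _ _ Hy (Rmin_r _ _)).
  assert (Hdy : m / 2 <= Cmod (1 - y)).
  { pose proof (Cmod_triangle (1 - y) (y - z)) as H.
    replace ((1 - y) + (y - z))%C with d in H by (unfold d; ring).
    fold m in H. lra. }
  assert (Hy0 : (1 - y)%C <> 0) by (apply Cmod_gt_0; lra).
  change (Cmod ((/ (1 - y) - / (1 - z)) - (y - z) * / (d * d)) <= eps * Cmod (y - z)).
  replace ((/ (1 - y) - / (1 - z)) - (y - z) * / (d * d))%C
    with ((y - z) * (y - z) * / ((1 - y) * (d * d)))%C
    by (unfold d; field; auto).
  rewrite !Cmod_mult, Cmod_inv, !Cmod_mult.
  2:{ intros H. apply (f_equal Cmod) in H. rewrite !Cmod_mult, Cmod_0 in H. fold m in H.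
      assert (0 < Cmod (1 - y) * (m * m)) by (repeat apply Rmult_lt_0_compat; lra). lra. }
  fold m. pose proof (Cmod_ge_0 (y - z)).
  replace (Cmod (y - z) * Cmod (y - z) * / (Cmod (1 - y) * (m * m)))
    with (Cmod (y - z) / (Cmod (1 - y) * (m * m)) * Cmod (y - z)) by (field; lra).
  apply Rmult_le_compat_r; [lra|].
  assert (0 < m * m) by nra.
  apply Rle_div_l; [nra|].
  assert (eps * (m / 2 * (m * m)) <= eps * (Cmod (1 - y) * (m * m))).
  { apply Rmult_le_compat_l; [lra|]. apply Rmult_le_compat_r; lra. }
  nra.
Qed.

(* [a - 2 (1 - a) z / (1 - z)], written so that [z] occurs only once. *)
Definition extremal_fun (a : R) (z : C) : C := (RtoC (2 - a) - RtoC (2 * (1 - a)) * / (1 - z))%C.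

Definition extremal_coef (a : R) (n : nat) : C :=
  match n with O => RtoC a | S _ => RtoC (- (2 * (1 - a))) end.

(** On the disk (1-x)^2 + y^2 < 2 (1-x), so 1 / (1-z) has real part above 1/2; the affine map with
    slope -2 (1-a) carries that half-plane into Re < 1. *)
Lemma extremal_fun_class_P (a : R) : a < 1 -> class_P (extremal_fun a).
Proof.
  intros Ha. split; intros z Hz.
  - unfold extremal_fun.
    apply (ex_derive_minus (fun _ => RtoC (2 - a))
             (fun w => scal (RtoC (2 * (1 - a))) (/ (1 - w))%C)).
    + apply ex_derive_const.
    + destruct (inv_one_minus_ex_derive z Hz) as [l Hl].
      exists (scal (RtoC (2 * (1 - a))) l).
      pose proof (filterdiff_scal_r_fct (K := C_AbsRing)
        (U := AbsRing_NormedModule C_AbsRing) (V := C_NormedModule)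
        (RtoC (2 * (1 - a))) _ _ Cmult_comm Hl) as H.
      apply (filterdiff_ext_lin _ _ _ H).
      intros w. change (RtoC (2 * (1 - a)) * (w * l) = w * (RtoC (2 * (1 - a)) * l))%C. ring.
  - destruct z as [x y].
    assert (Hxy : x ^ 2 + y ^ 2 < 1).
    { pose proof (Cmod2_alt (x, y)) as H. simpl Re in H; simpl Im in H.
      pose proof (Cmod_ge_0 (x, y)). nra. }
    assert (Hx : x < 1) by nra.
    assert (Hpos : 0 < (1 - x) ^ 2 + y ^ 2)
      by (pose proof (pow_lt (1 - x) 2 ltac:(lra)); pose proof (pow2_ge_0 y); lra).
    assert (Hq : 1 / 2 < (1 - x) / ((1 - x) ^ 2 + y ^ 2)).
    { apply (proj1 (Rlt_div_r (1 / 2) _ _ Hpos)). lra. }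
    replace (Re (extremal_fun a (x, y)))
      with (2 - a - 2 * (1 - a) * ((1 - x) / ((1 - x) ^ 2 + y ^ 2))).
    { nra. }
    unfold extremal_fun. simpl. field. lra.
Qed.

(** By the finite geometric sum, the n-th partial sum differs from the function by exactly c z^(n+1)
    / (1-z) with c = 2 (1-a). *)
Lemma extremal_fun_power_series (a : R) : power_series_on_disk (extremal_fun a) (extremal_coef a).
Proof.
  intros z Hz.
  pose proof (one_minus_neq_0 z Hz) as Hd.
  pose proof (proj1 (Cmod_gt_0 _) Hd) as Hm.
  set (c := RtoC (2 * (1 - a))).
  assert (Hsum : forall n, sum_n (fun k => scal (pow_n (K := C_Ring) z k) (extremal_coef a k : C_NormedModule)) n
     = (extremal_fun a z + c * (z ^ (S n) * / (1 - z)))%C).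
  { induction n as [|n IH].
    - rewrite sum_O. change (1 * RtoC a = extremal_fun a z + c * (z ^ 1 * / (1 - z)))%C.
      unfold extremal_fun, c. rewrite !RtoC_minus, !RtoC_mult, !RtoC_minus. field. exact Hd.
    - rewrite sum_Sn, IH.
      change (extremal_fun a z + c * (z ^ S n * / (1 - z)) + z ^ S n * RtoC (- (2 * (1 - a)))
        = extremal_fun a z + c * (z ^ S (S n) * / (1 - z)))%C.
      rewrite RtoC_opp. fold c. rewrite (Cpow_S z (S n)). field. exact Hd. }
  unfold is_pseries, is_series.
  apply filterlim_locally. intros eps.
  (* The summand 1 in the denominator covers c = 0, that is a = 1. *)
  destruct (pow_lt_1_zero (Cmod z) ltac:(rewrite Rabs_right; [exact Hz|apply Rle_ge, Cmod_ge_0])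
     (eps * Cmod (1 - z) / (1 + Cmod c))) as [N HN].
  { pose proof (Cmod_ge_0 c). apply Rdiv_lt_0_compat; [|lra].
    apply Rmult_lt_0_compat; [apply cond_pos|exact Hm]. }
  exists N. intros n Hn.
  apply C_NormedModule_mixin_compat1. rewrite Hsum.
  change (Cmod (extremal_fun a z + c * (z ^ (S n) * / (1 - z)) - extremal_fun a z) < eps).
  replace (extremal_fun a z + c * (z ^ (S n) * / (1 - z)) - extremal_fun a z)%C
    with (c * (z ^ (S n) * / (1 - z)))%C by ring.
  rewrite !Cmod_mult, Cmod_inv, Cmod_pow by exact Hd.
  specialize (HN (S n) ltac:(lia)). apply Rabs_def2 in HN. destruct HN as [HN _].
  pose proof (Cmod_ge_0 c). pose proof (cond_pos eps).
  assert (0 <= Cmod z ^ S n) by (apply pow_le, Cmod_ge_0).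
  apply Rlt_div_r in HN; [|lra].
  replace (Cmod c * (Cmod z ^ S n * / Cmod (1 - z)))
    with (Cmod c * Cmod z ^ S n / Cmod (1 - z)) by (field; lra).
  apply Rlt_div_l; nra.
Qed.

Lemma Cmod_extremal_coef_S (a : R) (n : nat) :
  a < 1 -> Cmod (extremal_coef a (S n)) = 2 * (1 - a).
Proof.
  intros Ha. simpl extremal_coef. rewrite Cmod_R, Rabs_left; lra.
Qed.

(** * Comparison of 1 - x^p with 1 - x *)

Lemma rpow_pos (x y : R) : 0 < x -> rpow x y = Rpower x y.
Proof. intros Hx. unfold rpow. destruct (Req_EM_T x 0); [lra|reflexivity]. Qed.

Lemma rpow_0 (y : R) : rpow 0 y = 0.
Proof. unfold rpow. destruct (Req_EM_T 0 0); [reflexivity|lra]. Qed.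

(** Concavity: x^p lies below its tangent at 1. The slope p is the source of the constant 2/p in
    (i). *)
Lemma rpow_le_tangent (x p : R) : 0 <= x -> 0 < p <= 1 -> rpow x p <= 1 - p * (1 - x).
Proof.
  intros [Hx|<-] Hp; [|rewrite rpow_0; lra].
  rewrite rpow_pos by exact Hx. unfold Rpower.
  set (t := ln x). assert (Et : exp t = x) by apply exp_ln, Hx.
  (* Weighted AM-GM: with s = exp (p t), apply 1 + u <= exp u to x / s and 1 / s. *)
  pose proof (exp_ineq1_le (t - p * t)) as H1.
  pose proof (exp_ineq1_le (- (p * t))) as H2.
  pose proof (exp_pos (p * t)) as Hs.
  assert (E1 : exp t = exp (p * t) * exp (t - p * t))
    by (rewrite <- exp_plus; f_equal; ring).
  assert (E2 : 1 = exp (p * t) * exp (- (p * t)))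
    by (rewrite <- exp_plus, Rplus_opp_r, exp_0; reflexivity).
  assert (1 <= p * exp (t - p * t) + (1 - p) * exp (- (p * t))) by nra.
  nra.
Qed.

Lemma rpow_ge_base (x p : R) : 0 <= x <= 1 -> 0 < p <= 1 -> x <= rpow x p.
Proof.
  intros [[Hx|<-] Hx1] Hp; [|rewrite rpow_0; lra].
  rewrite rpow_pos by exact Hx. rewrite <- (Rpower_1 x Hx) at 1. unfold Rpower.
  assert (ln x <= 0) by (rewrite <- ln_1; apply ln_le; lra).
  assert (Hle : 1 * ln x <= p * ln x) by nra.
  destruct Hle as [Hlt|Heq]; [left; apply exp_increasing, Hlt | rewrite Heq; lra].
Qed.

(** A converse to the tangent bound up to the factor 1/x, which tends to 1 as x -> 1. It combines 1
    - x^p <= p ln (1/x) with ln (1/x) <= 1/x - 1. *)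
Lemma one_minus_rpow_le (x p : R) : 0 < x -> 0 < p -> 1 - rpow x p <= p * (1 - x) / x.
Proof.
  intros Hx Hp. rewrite rpow_pos by exact Hx. unfold Rpower.
  pose proof (exp_ineq1_le (p * ln x)) as H1.
  pose proof (exp_ineq1_le (ln (/ x))) as H2.
  rewrite exp_ln in H2 by (apply Rinv_0_lt_compat, Hx). rewrite ln_Rinv in H2 by exact Hx.
  replace (p * (1 - x) / x) with (p * (/ x - 1)) by (field; lra).
  nra.
Qed.

Lemma rpow_INR (x : R) (p : nat) : 0 <= x -> (0 < p)%nat -> rpow x (INR p) = x ^ p.
Proof.
  intros [Hx|<-] Hp.
  - rewrite rpow_pos by exact Hx. apply Rpower_pow, Hx.
  - rewrite rpow_0, pow_i; [reflexivity|exact Hp].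
Qed.

Lemma one_minus_rpow_INR (x : R) (p : nat) :
  0 <= x -> (0 < p)%nat ->
  1 - rpow x (INR p) = sum_f_R0 (fun k => x ^ k) (p - 1) * (1 - x).
Proof.
  intros Hx Hp. rewrite rpow_INR by assumption.
  pose proof (GP_finite x (p - 1)) as H. replace (p - 1 + 1)%nat with p in H by lia.
  lra.
Qed.

Lemma sum_pow_ge_1 (x : R) (n : nat) : 0 <= x -> 1 <= sum_f_R0 (fun k => x ^ k) n.
Proof.
  intros Hx. induction n as [|n IH]; [simpl; lra|rewrite tech5].
  pose proof (pow_le x (S n) Hx). lra.
Qed.

(** * Upper bounds for B_f *)

Lemma class_F_ex_series (zeta : nat -> R -> R) (r : R) :
  class_F zeta -> 0 <= r < 1 -> ex_series (fun n => zeta n r).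
Proof.
  intros (_ & _ & HF) Hr. destruct (HF r Hr) as [delta Hcv].
  (* This is the limit built into [CVU_dom]; uniform convergence is used at the centre r only. *)
  exists (real (Lim_seq (sum_n (fun n => zeta n r)))).
  apply filterlim_locally. intros eps.
  destruct (Hcv eps) as [N HN]. exists N. intros n Hn.
  apply (HN n Hn r). split; [exact Hr|].
  rewrite Rminus_diag, Rabs_R0. apply cond_pos.
Qed.

Lemma Phi1_nonneg (zeta : nat -> R -> R) (r : R) :
  class_F zeta -> 0 <= r < 1 -> 0 <= Phi1 zeta r.
Proof.
  intros HF Hr. unfold Phi1.
  replace 0 with (Series (fun _ => 0 * 0)) by (rewrite Series_scal_l; ring).
  apply Series_le.
  - intros n. rewrite Rmult_0_l. split; [lra|apply HF, Hr].
  - apply (ex_series_incr_1 (fun n => zeta n r)), class_F_ex_series; assumption.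
Qed.

Lemma B_upper_bound (f : C -> C) (a : nat -> C) (a0 : R) (zeta : nat -> R -> R) (p r : R) :
  class_P f -> power_series_on_disk f a -> a O = RtoC a0 ->
  class_F zeta -> 0 <= r < 1 ->
  ex_series (B_tail a zeta r) /\
  B a zeta p r <= rpow a0 p * zeta O r + 2 * (1 - a0) * Phi1 zeta r.
Proof.
  intros HP Hf Ha0 HF Hr.
  assert (Hex := proj1 (ex_series_incr_1 _) (class_F_ex_series zeta r HF Hr)).
  assert (Hbd : forall n, 0 <= B_tail a zeta r n <= 2 * (1 - a0) * zeta (S n) r).
  { intros n. unfold B_tail. assert (Hz : 0 <= zeta (S n) r) by (apply HF, Hr).
    pose proof (class_P_coeff_bound f a (S n) HP Hf ltac:(lia)) as Hc.
    rewrite Ha0, re_RtoC in Hc. split.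
    - apply Rmult_le_pos; [apply Cmod_ge_0|exact Hz].
    - apply Rmult_le_compat_r; assumption. }
  assert (Hex' : ex_series (fun n => 2 * (1 - a0) * zeta (S n) r))
    by (apply (ex_series_scal (K := R_AbsRing) (V := R_NormedModule) (2 * (1 - a0))), Hex).
  split.
  - apply (ex_series_le (V := R_CompleteNormedModule) _ _) with (2 := Hex').
    intros n. change (Rabs (B_tail a zeta r n) <= 2 * (1 - a0) * zeta (S n) r).
    rewrite Rabs_right; [apply Hbd|apply Rle_ge, Hbd].
  - unfold B, Phi1. rewrite Ha0, re_RtoC, <- Series_scal_l.
    apply Rplus_le_compat_l, Series_le; [exact Hbd|exact Hex'].
Qed.

(** Equality in [B_upper_bound], because every coefficient after the first has modulus exactly 2
    (1-a). *)
Lemma B_extremal_coef (a : R) (zeta : nat -> R -> R) (p r : R) :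
  a < 1 ->
  B (extremal_coef a) zeta p r = rpow a p * zeta O r + 2 * (1 - a) * Phi1 zeta r.
Proof.
  intros Ha. unfold B, Phi1. f_equal.
  rewrite <- Series_scal_l. apply Series_ext. intros n.
  unfold B_tail. rewrite Cmod_extremal_coef_S by exact Ha. reflexivity.
Qed.

Lemma extremal_admissible (a : R) : 0 <= a < 1 -> admissible (extremal_fun a) (extremal_coef a).
Proof.
  intros Ha. split; [apply extremal_fun_class_P; lra|].
  split; [apply extremal_fun_power_series|]. exists a. split; [reflexivity|exact Ha].
Qed.

(** Common to both parts: s is p in (i) and 1 + ... + a_0^(p-1) in (ii). The chain is 2 (1-a_0)
    Phi_1 <= s (1-a_0) zeta_0 <= (1 - a_0^p) zeta_0. *)
Lemma B_le_zeta0_of_Phi1_le (f : C -> C) (a : nat -> C) (a0 : R)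
    (zeta : nat -> R -> R) (p s r : R) :
  class_P f -> power_series_on_disk f a -> a O = RtoC a0 -> a0 < 1 ->
  class_F zeta -> 0 <= r < 1 -> 0 < s -> s * (1 - a0) <= 1 - rpow a0 p ->
  zeta O r >= 2 / s * Phi1 zeta r ->
  B_le_zeta0 a zeta p r.
Proof.
  intros HP Hf Ha0 Hlt HF Hr Hs Hp Hz.
  destruct (B_upper_bound f a a0 zeta p r HP Hf Ha0 HF Hr) as [Hex HB].
  split; [exact Hex|].
  pose proof (Phi1_nonneg zeta r HF Hr) as HPhi.
  assert (Hz' : 2 * Phi1 zeta r <= s * zeta O r).
  { apply Rge_le, (Rmult_le_compat_l s) in Hz; [|lra].
    replace (s * (2 / s * Phi1 zeta r)) with (2 * Phi1 zeta r) in Hz by (field; lra).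
    exact Hz. }
  assert (Hz0 : 0 <= zeta O r) by (apply HF, Hr).
  apply Rle_trans with (1 := HB).
  apply (Rmult_le_compat_l (1 - a0)) in Hz'; [|lra].
  apply (Rmult_le_compat_r (zeta O r)) in Hp; [|lra].
  nra.
Qed.

Lemma B_le_zeta0_real_exponent (f : C -> C) (a : nat -> C) (zeta : nat -> R -> R) (p r : R) :
  admissible f a -> 0 < p <= 1 -> class_F zeta -> 0 <= r < 1 ->
  zeta O r >= 2 / p * Phi1 zeta r -> B_le_zeta0 a zeta p r.
Proof.
  intros (HP & Hf & a0 & Ha0 & Hlt) Hp HF Hr Hz.
  apply (B_le_zeta0_of_Phi1_le f a a0 zeta p p); try assumption; try lra.
  pose proof (rpow_le_tangent a0 p ltac:(lra) Hp). lra.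
Qed.

Lemma B_le_zeta0_nat_exponent (f : C -> C) (a : nat -> C) (a0 : R) (zeta : nat -> R -> R)
    (p : nat) (r : R) :
  class_P f -> power_series_on_disk f a -> a O = RtoC a0 -> 0 <= a0 < 1 ->
  (0 < p)%nat -> class_F zeta -> 0 <= r < 1 ->
  zeta O r >= 2 / sum_f_R0 (fun k => a0 ^ k) (p - 1) * Phi1 zeta r ->
  B_le_zeta0 a zeta (INR p) r.
Proof.
  intros HP Hf Ha0 Hlt Hp HF Hr Hz.
  pose proof (sum_pow_ge_1 a0 (p - 1) ltac:(lra)).
  apply (B_le_zeta0_of_Phi1_le f a a0 zeta _ (sum_f_R0 (fun k => a0 ^ k) (p - 1)));
    try assumption; try lra.
  rewrite one_minus_rpow_INR by (assumption || lra). lra.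
Qed.

(** * Sharpness *)

(** The extremal function with constant term x gives at least x^p zeta_0 >= x zeta_0, and x may be
    taken arbitrarily close to 1. *)
Lemma is_lub_B_real_exponent (zeta : nat -> R -> R) (p r : R) :
  0 < p <= 1 -> class_F zeta -> 0 <= r < 1 ->
  zeta O r >= 2 / p * Phi1 zeta r ->
  is_lub (fun x => exists (g : C -> C) (b : nat -> C),
            admissible g b /\ x = B b zeta p r) (zeta O r).
Proof.
  intros Hp HF Hr Hz. split.
  - intros x (g & b & Hadm & ->). eapply B_le_zeta0_real_exponent; eassumption.
  - intros M HM.
    pose proof (Phi1_nonneg zeta r HF Hr) as HPhi.
    assert (Hz0 : 0 <= zeta O r) by (apply HF, Hr).
    assert (Hlow : forall x, 0 <= x < 1 -> x * zeta O r <= M).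
    { intros x Hx. apply Rle_trans with (B (extremal_coef x) zeta p r).
      - rewrite B_extremal_coef by lra.
        pose proof (rpow_ge_base x p ltac:(lra) Hp). nra.
      - apply HM. exists (extremal_fun x), (extremal_coef x).
        split; [apply extremal_admissible, Hx|reflexivity]. }
    apply le_epsilon. intros e He.
    set (d := e / (zeta O r + 1 + e)).
    assert (Hd : d * (zeta O r + 1 + e) = e) by (unfold d; field; lra).
    assert (Hd01 : 0 < d < 1).
    { split; [apply Rdiv_lt_0_compat; lra|]. unfold d. apply Rlt_div_l; lra. }
    specialize (Hlow (1 - d) ltac:(lra)). nra.
Qed.

(** By [one_minus_rpow_le], the excess of B_f over zeta_0 for the extremal function is at least
    (1-x) (2 Phi_1 - p zeta_0 / x), which is positive for x close to 1. *)
Lemma extremal_exceeds_zeta0 (zeta : nat -> R -> R) (p r : R) :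
  0 < p -> 0 <= zeta O r -> zeta O r < 2 / p * Phi1 zeta r ->
  exists x, 0 <= x < 1 /\ zeta O r < B (extremal_coef x) zeta p r.
Proof.
  intros Hp Hz0 Hz.
  assert (Hz' : p * zeta O r < 2 * Phi1 zeta r).
  { apply (Rmult_lt_compat_l p) in Hz; [|lra].
    replace (p * (2 / p * Phi1 zeta r)) with (2 * Phi1 zeta r) in Hz by (field; lra).
    exact Hz. }
  assert (0 <= p * zeta O r) by (apply Rmult_le_pos; lra).
  (* Any x < 1 with p zeta_0 < 2 x Phi_1 works. *)
  set (q := p * zeta O r / (2 * Phi1 zeta r)).
  assert (Hq : q * (2 * Phi1 zeta r) = p * zeta O r) by (unfold q; field; lra).
  assert (Hq1 : 0 <= q < 1).
  { split; [apply Rdiv_le_0_compat; lra|]. unfold q. apply Rlt_div_l; lra. }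
  (* The midpoint of q and 1 stays positive even when q = 0, so division by x is safe. *)
  set (x := (1 + q) / 2). assert (Hx : 0 < x < 1) by (unfold x; lra).
  exists x. split; [lra|]. rewrite B_extremal_coef by lra.
  pose proof (one_minus_rpow_le x p ltac:(lra) Hp) as Hb.
  apply (Rmult_le_compat_r (zeta O r)) in Hb; [|exact Hz0].
  assert (Hlt : p * zeta O r < x * (2 * Phi1 zeta r)).
  { rewrite <- Hq. apply Rmult_lt_compat_r; unfold x; lra. }
  assert (Hlt' : p * (1 - x) / x * zeta O r < 2 * (1 - x) * Phi1 zeta r).
  { replace (p * (1 - x) / x * zeta O r) with ((1 - x) * (p * zeta O r) / x)
      by (field; lra).
    apply Rlt_div_l; [lra|]. apply (Rmult_lt_compat_l (1 - x)) in Hlt; lra. }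
  lra.
Qed.

(** The factorization of 1 - a^p is exact, so for fixed a the sign of B_f - zeta_0 is that of the
    last factor: zero at a root, positive where the condition fails. *)
Lemma B_extremal_coef_INR (a : R) (zeta : nat -> R -> R) (p : nat) (r : R) :
  0 <= a < 1 -> (0 < p)%nat ->
  B (extremal_coef a) zeta (INR p) r
  = zeta O r + sum_f_R0 (fun k => a ^ k) (p - 1) * (1 - a) *
      (2 / sum_f_R0 (fun k => a ^ k) (p - 1) * Phi1 zeta r - zeta O r).
Proof.
  intros Ha Hp. rewrite B_extremal_coef by lra.
  pose proof (one_minus_rpow_INR a p ltac:(lra) Hp) as H.
  pose proof (sum_pow_ge_1 a (p - 1) ltac:(lra)).
  set (s := sum_f_R0 (fun k => a ^ k) (p - 1)) in *.
  replace (rpow a (INR p)) with (1 - s * (1 - a)) by lra. field. lra.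
Qed.

Theorem theorem1 :
  forall (f : C -> C) (a : nat -> C) (a0 : R),
  class_P f -> power_series_on_disk f a -> a O = RtoC a0 -> 0 <= a0 < 1 ->
  (* (i) *)
  (forall (p : R) (zeta : nat -> R -> R) (R1 : R),
     0 < p <= 1 -> class_F zeta ->
     is_min_pos_root (zeta O) (fun r => 2 / p * Phi1 zeta r) R1 ->
     (forall r, 0 <= r <= R1 -> zeta O r >= 2 / p * Phi1 zeta r) ->
     (forall r, 0 <= r <= R1 -> B_le_zeta0 a zeta p r)
     (* sharpness: zeta_0(r) is the least upper bound over all admissible functions *)
     /\ (forall r, 0 <= r <= R1 ->
           is_lub (fun x => exists (g : C -> C) (b : nat -> C),
                              admissible g b /\ x = B b zeta p r)
                  (zeta O r))
     (* R1 cannot be improved *)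
     /\ (forall eps, 0 < eps -> R1 + eps <= 1 ->
           (forall r, R1 < r < R1 + eps -> zeta O r < 2 / p * Phi1 zeta r) ->
           forall R', R1 < R' ->
           exists (g : C -> C) (b : nat -> C) (r : R),
             admissible g b /\ 0 <= r <= R' /\ r < 1 /\
             zeta O r < B b zeta p r))
  /\
  (* (ii) *)
  (forall (p : nat) (zeta : nat -> R -> R) (Rp : R),
     (1 < p)%nat -> class_F zeta ->
     is_min_pos_root (zeta O)
       (fun r => 2 / sum_f_R0 (fun k => a0 ^ k) (p - 1) * Phi1 zeta r) Rp ->
     (forall r, 0 <= r <= Rp ->
        zeta O r >= 2 / sum_f_R0 (fun k => a0 ^ k) (p - 1) * Phi1 zeta r) ->
     (forall r, 0 <= r <= Rp -> B_le_zeta0 a zeta (INR p) r)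
     (* sharpness, for the given a_0: equality is attained at Rp, and Rp is
        optimal when the condition fails immediately to its right *)
     /\ (exists (g : C -> C) (b : nat -> C),
           class_P g /\ power_series_on_disk g b /\ b O = RtoC a0 /\
           B b zeta (INR p) Rp = zeta O Rp)
     /\ (forall eps, 0 < eps -> Rp + eps <= 1 ->
           (forall r, Rp < r < Rp + eps ->
              zeta O r < 2 / sum_f_R0 (fun k => a0 ^ k) (p - 1) * Phi1 zeta r) ->
           forall R', Rp < R' ->
           exists (g : C -> C) (b : nat -> C) (r : R),
             class_P g /\ power_series_on_disk g b /\ b O = RtoC a0 /\
             0 <= r <= R' /\ r < 1 /\
             zeta O r < B b zeta (INR p) r))
  /\
  (* the case p = 2 *)
  (forall (zeta : nat -> R -> R) (R2 : R),
     class_F zeta ->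
     is_min_pos_root (zeta O) (fun r => 2 / (1 + a0) * Phi1 zeta r) R2 ->
     (forall r, 0 <= r <= R2 -> zeta O r >= 2 / (1 + a0) * Phi1 zeta r) ->
     forall r, 0 <= r <= R2 -> B_le_zeta0 a zeta 2 r).
Proof.
  intros f a a0 HP Hf Ha0 H01.
  split; [|split].
  - intros p zeta R1 Hp HF ([HR0 HR1] & _ & _) Hz.
    split; [|split].
    + intros r Hr. apply (B_le_zeta0_real_exponent f); [|exact Hp|exact HF|lra|apply Hz, Hr].
      split; [exact HP|split; [exact Hf|exists a0; auto]].
    + intros r Hr. apply is_lub_B_real_exponent; [exact Hp|exact HF|lra|apply Hz, Hr].
    + intros eps Heps HR1e Hfail R' HR'.
      (* A point to the right of [R1], inside the interval of failure and below [R']; it is below 1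
         since [R1 + eps <= 1]. *)
      set (r := (R1 + Rmin (R1 + eps) R') / 2).
      assert (Hr : R1 < r < Rmin (R1 + eps) R').
      { assert (R1 < Rmin (R1 + eps) R') by (apply Rmin_glb_lt; lra). unfold r; lra. }
      pose proof (Rmin_l (R1 + eps) R'). pose proof (Rmin_r (R1 + eps) R').
      destruct (extremal_exceeds_zeta0 zeta p r) as (x & Hx & HB);
        [lra|apply HF; lra|apply Hfail; lra|].
      exists (extremal_fun x), (extremal_coef x), r.
      split; [apply extremal_admissible, Hx|repeat split; lra].
  - intros p zeta Rp Hp HF ([HR0 HR1] & Hroot & _) Hz.
    assert (Hext : class_P (extremal_fun a0) /\ power_series_on_disk (extremal_fun a0) (extremal_coef a0)
                   /\ extremal_coef a0 O = RtoC a0).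
    { split; [apply extremal_fun_class_P; lra|].
      split; [apply extremal_fun_power_series|reflexivity]. }
    split; [|split].
    + intros r Hr.
      apply (B_le_zeta0_nat_exponent f a a0); try assumption; [lia|lra|apply Hz, Hr].
    + exists (extremal_fun a0), (extremal_coef a0). do 3 (split; [apply Hext|]).
      rewrite B_extremal_coef_INR by (assumption || lia). rewrite <- Hroot. ring.
    + intros eps Heps HRe Hfail R' HR'.
      set (r := (Rp + Rmin (Rp + eps) R') / 2).
      assert (Hr : Rp < r < Rmin (Rp + eps) R').
      { assert (Rp < Rmin (Rp + eps) R') by (apply Rmin_glb_lt; lra). unfold r; lra. }
      pose proof (Rmin_l (Rp + eps) R'). pose proof (Rmin_r (Rp + eps) R').
      (* Unlike in (i), the constant term stays at the given a_0: the condition itself depends on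
         a_0, and its failure at r already makes the extremal value exceed zeta_0. *)
      exists (extremal_fun a0), (extremal_coef a0), r. do 3 (split; [apply Hext|]).
      split; [lra|]. split; [lra|].
      rewrite B_extremal_coef_INR by (assumption || lia).
      specialize (Hfail r ltac:(lra)).
      pose proof (sum_pow_ge_1 a0 (p - 1) ltac:(lra)).
      assert (0 < sum_f_R0 (fun k => a0 ^ k) (p - 1) * (1 - a0))
        by (apply Rmult_lt_0_compat; lra).
      rewrite <- Rplus_0_r at 1. apply Rplus_lt_compat_l, Rmult_lt_0_compat; lra.
  - intros zeta R2 HF ([HR0 HR1] & _ & _) Hz r Hr.
    apply (B_le_zeta0_nat_exponent f a a0 zeta 2); try assumption; [lia|lra|].
    replace (sum_f_R0 (fun k => a0 ^ k) (2 - 1)) with (1 + a0) by (simpl; ring).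
    apply Hz, Hr.
Qed.
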